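(* If $H$ is a $4$-uniform hypergraph with $n_H$ vertices and $m_H$ edges, then $\tau_g(H) \le \frac{71}{252}(n_H + m_H)$.
   Context: A hypergraph $H=(V(H),E(H))$ is a finite set $V(H)$ of vertices together with a finite multiset $E(H)$ of nonempty subsets of $V(H)$, called edges; $n_H=|V(H)|$ and $m_H=|E(H)|$ (counted with multiplicity). $H$ is $k$-uniform if every edge has exactly $k$ vertices. A vertex hits an edge if it belongs to that edge; a transversal is a set of vertices having nonempty intersection with every edge. The transversal game on $H$ is played by two players, Edge-hitter and Staller, who take turns choosing a vertex of $H$; each chosen vertex must hit at least one edge not hit by the vertices previously chosen. The game ends when the set of chosen vertices is a transversal of $H$. Edge-hitter wishes to minimize, and Staller wishes to maximize, the total number of vertices chosen. The game transversal number $\tau_g(H)$ is the total number of vertices chosen when Edge-hitter moves first and both players play optimally. *)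

(* Defs.v *)
From mathcomp Require Import all_boot.
From mathcomp Require Import finmap multiset.

Set Implicit Arguments.
Unset Strict Implicit.
Unset Printing Implicit Defensive.

Local Open Scope mset_scope.
Local Open Scope nat_scope.

Record hypergraph := Hypergraph {
  vertex : finType;
  edges : {mset {set vertex}};
  edges_neq0 : forall e, e \in edges -> e != set0
}.

Definition n_of (H : hypergraph) : nat := #|vertex H|.

(* size of the underlying sequence: edges are counted with multiplicity *)
Definition m_of (H : hypergraph) : nat := size (edges H).

Definition uniform (k : nat) (H : hypergraph) : Prop :=
  forall e, e \in edges H -> #|e| = k.

Definition hits (H : hypergraph) (v : vertex H) (e : {set vertex H}) : bool :=
  v \in e.

Definition transversal (H : hypergraph) (D : {set vertex H}) : bool :=
  all (fun e => D :&: e != set0) (edges H).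

(* v may be chosen when D is the set of vertices chosen so far *)
Definition legal (H : hypergraph) (D : {set vertex H}) (v : vertex H) : bool :=
  has (fun e => hits v e && ~~ [exists u in D, hits u e]) (edges H).

Inductive player := EdgeHitter | Staller.

(* Optimal number of further moves, with p on turn and D the set of vertices
   chosen so far. The first argument is fuel: a legal move adds a new vertex to
   D, so #|~: D| units suffice. The default values of min and max are harmless,
   since a legal move exists whenever D is not a transversal and the remaining
   length never exceeds #|vertex H|; the resulting fuel-free minimax equations
   are game_value_transversal, game_value_EdgeHitter and game_value_Staller. *)
Fixpoint game_value_rec (H : hypergraph) (fuel : nat) (p : player)
    (D : {set vertex H}) : nat :=
  if fuel is fuel'.+1 then
    if transversal D then 0
    else match p with
      | EdgeHitter => (\big[minn/#|vertex H|]_(v | legal D v)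
                         game_value_rec fuel' Staller (v |: D)).+1
      | Staller => (\max_(v | legal D v)
                         game_value_rec fuel' EdgeHitter (v |: D)).+1
      end
  else 0.

Definition game_value (H : hypergraph) (p : player) (D : {set vertex H}) :=
  game_value_rec #|~: D| p D.

Definition tau_g (H : hypergraph) : nat :=
  game_value EdgeHitter (@set0 (vertex H)).

Lemma bigmin_leP (T : finType) (P : pred T) (F : T -> nat) b k :
  reflect (b <= k \/ exists2 v, P v & F v <= k)
          (\big[minn/b]_(v | P v) F v <= k).
Proof.
have -> : (\big[minn/b]_(v | P v) F v <= k) =
   (b <= k) || [exists v, P v && (F v <= k)].
  have -> : [exists v, P v && (F v <= k)] =
      has (fun v => P v && (F v <= k)) (index_enum T).
    apply/existsP/hasP=> [[v Pv]|[v _ Pv]]; exists v => //.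
  elim: (index_enum T) => [|v s IH]; first by rewrite big_nil orbF.
  by rewrite big_cons /=; case: (P v) => //=; rewrite geq_min IH orbCA.
apply: (iffP orP) => -[|H']; try by left.
  by right; case/existsP: H' => v /andP[]; exists v.
by right; case: H' => v Pv Fv; apply/existsP; exists v; rewrite Pv.
Qed.

Section Theory.
Variable H : hypergraph.
Implicit Types (D : {set vertex H}) (v : vertex H) (p : player).

Lemma legal_notin D v : legal D v -> v \notin D.
Proof.
case/hasP=> e _ /andP[ve /existsPn /(_ v)].
by rewrite ve andbT.
Qed.

Lemma legal_card D v : legal D v -> #|~: D| = #|~: (v |: D)|.+1.
Proof.
move=> /legal_notin vD; rewrite (cardsD1 v (~: D)) inE vD add1n.
by congr (#|pred_of_set _|.+1); apply/setP=> u; rewrite !inE negb_or.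
Qed.

Lemma legal_exists D : ~~ transversal D -> exists v, legal D v.
Proof.
case/allPn=> e eE /negPn /eqP De0.
have /set0Pn[v ve] := edges_neq0 eE.
exists v; apply/hasP; exists e => //; rewrite /hits ve /=.
apply/existsP=> -[u /andP[uD ue]].
by have := in_set0 u; rewrite -De0 inE uD ue.
Qed.

Lemma transversal_card D : ~~ transversal D -> 0 < #|~: D|.
Proof. by case/legal_exists=> v /legal_card ->. Qed.

Lemma transversal_no_legal D : transversal D = ~~ [exists v, legal D v].
Proof.
apply/idP/existsPn => [tD v|noL].
  apply/hasPn=> e eE; rewrite negb_and negbK; apply/orP; right.
  have /set0Pn[u] := allP tD e eE; rewrite inE => /andP[uD ue].
  by apply/existsP; exists u; rewrite uD.
by apply/negPn/negP=> /legal_exists[v]; apply/negP.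
Qed.

Lemma game_value_rec_le fuel p D : game_value_rec fuel p D <= #|~: D|.
Proof.
elim: fuel p D => [|n IH] p D //=; case: ifPn => // tD.
have [v Lv] := legal_exists tD.
case: p; last first.
  have := transversal_card tD; case E: #|~: D| => [//|c] _; rewrite ltnS.
  apply/bigmax_leqP=> u Lu; apply: leq_trans (IH _ _) _.
  by move: E; rewrite (legal_card Lu) => -[->].
rewrite (legal_card Lv) ltnS; apply/bigmin_leP; right; exists v => //.
Qed.

Lemma game_value_transversal p D : transversal D -> game_value p D = 0.
Proof. by rewrite /game_value; case: #|~: D| => //= n ->. Qed.

Lemma game_value_EdgeHitter D k : ~~ transversal D ->
  game_value EdgeHitter D <= k <->
  exists2 v, legal D v & (game_value Staller (v |: D)).+1 <= k.
Proof.
move=> tD; have [v Lv] := legal_exists tD.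
rewrite /game_value; case E: #|~: D| => [|n].
  by have := transversal_card tD; rewrite E.
rewrite /= (negPf tD).
have En u : legal D u -> #|~: (u |: D)| = n.
  by move=> Lu; move: E; rewrite (legal_card Lu) => -[->].
case: k => [|k]; first by split=> // -[].
rewrite ltnS; split=> [/bigmin_leP[nk|[u Lu Fu]]|[u Lu Fu]].
- exists v => //; rewrite ltnS; apply: leq_trans nk.
  exact: leq_trans (game_value_rec_le _ _ _) (max_card _).
- by exists u => //; rewrite En.
- by apply/bigmin_leP; right; exists u => //; rewrite -(En u Lu).
Qed.

Lemma game_value_Staller D k : ~~ transversal D ->
  k <= game_value Staller D <->
  exists2 v, legal D v & k <= (game_value EdgeHitter (v |: D)).+1.
Proof.
move=> tD; have [v Lv] := legal_exists tD.
rewrite /game_value; case E: #|~: D| => [|n].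
  by have := transversal_card tD; rewrite E.
rewrite /= (negPf tD).
have En u : legal D u -> #|~: (u |: D)| = n.
  by move=> Lu; move: E; rewrite (legal_card Lu) => -[->].
have LP : 0 < #|legal D| by apply/card_gt0P; exists v.
have [w Lw Ew] := eq_bigmax_cond
  (fun u => game_value_rec n EdgeHitter (u |: D)) LP.
split=> [|[u Lu ku]].
  by rewrite Ew => kw; exists w => //; rewrite En.
apply: leq_trans ku _; rewrite ltnS En //.
by apply: (leq_bigmax_cond
  (F := fun x => game_value_rec n EdgeHitter (x |: D))).
Qed.

End Theory.

(* Main.v *)
Require Import Defs.
From mathcomp Require Import finmap multiset.
From mathcomp Require Import all_boot all_order all_algebra.
From mathcomp Require Import zify.
Import Order.TTheory GRing.Theory Num.Theory.

(** A position of the game is given by the set [U] of edges not yet hit. Its active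
    vertices, those on some edge of [U], are the legal moves; a move [v] removes
    from [U] the edges at [v], and it makes inactive the vertices it dooms, which
    are [v] and the vertices all of whose edges it hits. The proof follows the
    quantity [p * #|U| + q * #|active U|], with weights [p] and [q] that change
    as the maximum degree falls, against a fixed price [c] for every move.
    Staller always removes at least one edge and one active vertex, and
    Edge-hitter, choosing a vertex of largest degree [d], removes [d] edges and
    one vertex. So a round pays for its two moves when
    [(d + 1) * p + 2 * q >= 2 * c].

    With [c = 252] and [p = q = 71] this holds for [d >= 5]; with
    [(c, p, q) = (378, 110, 103)] for [d >= 4]; with [(27, 11, 5)] for [d >= 3]
    ([greedy_bound]). By double counting, [4 * #|U| <= k * #|active U|] when
    the maximum degree is at most [k], so for [k = 4, 3, 2] the bound of the next
    phase is at most the one it replaces ([handshake], [edge_hitter_bound]).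

    For maximum degree 2 the bound wanted is [9] per move against
    [5 * #|U| + #|active U|], and the greedy count falls short by 1: it gives 17
    instead of 18. Call a position open if some edge contains both a vertex of
    degree 1 and a vertex of degree 2 ([open]). In an open position
    Edge-hitter can choose a vertex of degree 2 that dooms a second vertex, so a
    round is worth 18. In a position that is not open he may lose 1, but then
    the position that he reaches is open, and there the bound holds with 1 to
    spare ([maxdeg2_bound]). What must be excluded is that an open position is
    exhausted without the spare unit being earned, and this is a local
    count of the vertices around the edges hit in one round
    ([open_after_cheap_reply]). *)

Set Implicit Arguments.
Unset Strict Implicit.
Unset Printing Implicit Defensive.

(** * Edges left to hit, and their active vertices *)

Section Residual.
Variables (T I : finType) (F : I -> {set T}).
Implicit Types (U : {set I}) (u v w : T) (x y z f : I).

Definition star U v := [set i in U | v \in F i].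
Definition hit U v := [set i in U | v \notin F i].
Definition active U := [set v | star U v != set0].
Definition doomed U v := active U :\: active (hit U v).
Definition maxdeg k U := forall v, #|star U v| <= k.

Lemma star_hit U v u : star (hit U v) u = star U u :\: star U v.
Proof.
apply/setP=> i; rewrite !inE.
by case: (i \in U); case: (v \in F i); case: (u \in F i).
Qed.

Lemma maxdeg_hit k U v : maxdeg k U -> maxdeg k (hit U v).
Proof.
move=> dU u; apply: leq_trans (dU u).
by rewrite star_hit subset_leq_card ?subsetDl.
Qed.

Lemma card_hit U v : #|U| = #|hit U v| + #|star U v|.
Proof.
have -> : hit U v = U :\: star U v.
  by apply/setP=> i; rewrite !inE; case: (i \in U); rewrite ?andbT ?andbF.
have /setIidPr sU : star U v \subset U by apply/subsetP=> i /setIdP[].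
by rewrite -(cardsID (star U v) U) sU addnC.
Qed.

Lemma active_star U v : (v \in active U) = (0 < #|star U v|).
Proof. by rewrite inE card_gt0. Qed.

Lemma doomedE U v u :
  (u \in doomed U v) = (u \in active U) && (star U u \subset star U v).
Proof. by rewrite !inE star_hit negbK setD_eq0 andbC. Qed.

Lemma card_active_hit U v : #|active U| = #|active (hit U v)| + #|doomed U v|.
Proof.
rewrite -(cardsID (active (hit U v)) (active U)); congr (#|pred_of_set _| + _).
apply/setIidPr/subsetP=> u; rewrite !inE star_hit.
by apply: contra => /eqP->; rewrite set0D.
Qed.

Lemma doomed_self U v : v \in active U -> v \in doomed U v.
Proof. by move=> av; rewrite doomedE av /=. Qed.

Lemma card_doomed_gt0 U v : v \in active U -> 0 < #|doomed U v|.
Proof. by move=> /doomed_self vd; apply/card_gt0P; exists v. Qed.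

Definition weight p q U := p * #|U| + q * #|active U|.

Lemma weight_hit p q U v :
  weight p q U = weight p q (hit U v) + p * #|star U v| + q * #|doomed U v|.
Proof.
by rewrite /weight (card_active_hit U v) (card_hit U v) !mulnDr addnACA addnA.
Qed.

(** One round consists of a move of each player; only the first of the two needs to
    hit an edge for the set of edges left to shrink. *)
Lemma round_ind (P : {set I} -> Prop) :
  (forall U, (forall v u, v \in active U -> P (hit (hit U v) u)) -> P U) ->
  forall U, P U.
Proof.
move=> step U; have [n] := ubnP #|U|; elim: n U => // n IH U ltUn.
apply: step => v u; rewrite active_star => sv; apply: IH.
by move: ltUn sv; rewrite (card_hit U v) (card_hit (hit U v) u); clear; lia.
Qed.

Hypothesis F4 : forall i, #|F i| = 4.

Lemma active_exists U : U != set0 -> exists v, v \in active U.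
Proof.
case/set0Pn=> i iU; have /card_gt0P[v vi] : 0 < #|F i| by rewrite F4.
by exists v; rewrite inE; apply/set0Pn; exists i; rewrite inE iU.
Qed.

(** Both sides compare with the sum of the degrees. This is what makes the bound
    of one phase at most that of the phase with larger degrees. *)
Lemma handshake k U : maxdeg k U -> 4 * #|U| <= k * #|active U|.
Proof.
move=> dU.
have -> : 4 * #|U| = \sum_(i in U) \sum_(v in F i) 1.
  rewrite mulnC -sum_nat_const; apply: eq_bigr => i _.
  by rewrite sum1_card F4.
rewrite (exchange_big_dep (mem (active U))) /=; last first.
  move=> i v iU vi; rewrite inE; apply/set0Pn; exists i.
  by rewrite inE iU.
rewrite mulnC -sum_nat_const; apply: leq_sum => v _.
apply: leq_trans (dU v); rewrite sum1_card; apply: subset_leq_card.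
by apply/subsetP=> i; rewrite !inE.
Qed.

(** * Hypergraphs of maximum degree two *)

(** Regard the edges left as the nodes of a multigraph, in which a vertex of
    degree 2 is an arc and a vertex of degree 1 a dangling half-arc. Then [open]
    says that some node carries both an arc and a half-arc, that is, some
    component with an arc is not 4-regular. *)
Definition open U :=
  [exists v, exists u,
    [&& #|star U v| == 2, #|star U u| == 1 & star U u \subset star U v]].

Definition overlap f g := #|F f :&: F g|.
Definition lone U g := #|[set p in F g | star U p == [set g]]|.

(** A vertex of [F g] meets at most one other edge, so it is counted once. *)
Lemma edge_count U g : maxdeg 2 U -> g \in U ->
  lone U g + \sum_(h in U :\ g) overlap g h = 4.
Proof.
move=> dU gU; rewrite -(F4 g) -[RHS]sum1_card.
have -> : lone U g = \sum_(p in F g) (star U p == [set g]).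
  rewrite /lone -sum1_card big_mkcond [RHS]big_mkcond; apply: eq_bigr => p _.
  by rewrite inE; case: (p \in F g); case: eqP.
have -> : \sum_(h in U :\ g) overlap g h =
    \sum_(h in U :\ g) \sum_(p in F g | p \in F h) 1.
  by apply: eq_bigr => h _; rewrite sum1_card; apply: eq_card => p; rewrite inE.
rewrite (exchange_big_dep (mem (F g))) /=; last by move=> h p _ /andP[].
rewrite -big_split /=; apply: eq_bigr => p pg.
have -> : \sum_(h in U :\ g | (p \in F g) && (p \in F h)) 1 = #|star U p :\ g|.
  rewrite sum1_card; apply: eq_card => h.
  by rewrite unfold_in /= !inE pg /= andbA.
have gp : g \in star U p by rewrite inE gU.
have := dU p; rewrite (cardsD1 g) gp add1n ltnS => le1.
case: eqP => [->|ne]; first by rewrite setDv cards0.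
rewrite add0n; apply/eqP; rewrite eqn_leq le1 card_gt0 /=.
apply/eqP=> /eqP; rewrite setD_eq0 subset1 => /orP[/eqP//|/eqP e0].
by rewrite e0 inE in gp.
Qed.

Lemma edge_count_le U g s : maxdeg 2 U -> g \in U ->
  uniq s -> {subset s <= U :\ g} -> lone U g + \sum_(h <- s) overlap g h <= 4.
Proof.
move=> dU gU us sU; rewrite -(edge_count dU gU) leq_add2l big_uniq //=.
rewrite [leqLHS]big_mkcond [leqRHS]big_mkcond; apply: leq_sum => h _.
by case: ifP => // /sU ->.
Qed.

Lemma edge_count_cover U g s : maxdeg 2 U -> g \in U -> uniq s ->
  (forall h, h \in U -> h != g -> h \notin s -> overlap g h = 0) ->
  4 <= lone U g + \sum_(h <- s) overlap g h.
Proof.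
move=> dU gU us cov; rewrite -(edge_count dU gU) leq_add2l big_uniq //=.
rewrite [leqLHS]big_mkcond [leqRHS]big_mkcond; apply: leq_sum => h _.
rewrite !inE; case: ifP => // /andP[hg hU]; case: ifP => // /negbT hs.
by rewrite cov.
Qed.

(** Choosing a common vertex of [f] and [g] hits both edges, so it dooms all their
    common vertices and all vertices whose only edge is one of the two. *)
Lemma overlap_lone_le U f g b : maxdeg 2 U -> f \in U -> g \in U -> f != g ->
  (forall q, #|star U q| = 2 -> #|doomed U q| <= b) ->
  0 < overlap f g -> overlap f g + lone U f + lone U g <= b.
Proof.
move=> dU fU gU fg db /card_gt0P[q]; rewrite inE => /andP[qf qg].
have st p : p \in F f -> p \in F g -> star U p = [set f; g].
  move=> pf pg; apply/eqP; rewrite eq_sym eqEcard cards2 fg dU andbT.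
  by apply/subsetP=> i; rewrite !inE => /orP[] /eqP->; rewrite ?fU ?gU.
have sq := st q qf qg.
have := db q; rewrite sq cards2 fg => /(_ erefl); apply: leq_trans.
set A := F f :&: F g; set B := [set p in F f | star U p == [set f]].
set C := [set p in F g | star U p == [set g]].
have AB : [disjoint A & B].
  rewrite disjoint_subset; apply/subsetP=> p; rewrite !inE => /andP[pf pg].
  rewrite pf st //=; apply/eqP=> /setP/(_ g); rewrite !inE eqxx orbT.
  by rewrite eq_sym (negPf fg).
have ABC : [disjoint A :|: B & C].
  rewrite disjoint_subset; apply/subsetP=> p; rewrite !inE.
  case/orP=> /andP[pf].
    move=> pg; rewrite pg st //=; apply/eqP=> /setP/(_ f); rewrite !inE eqxx.
    by rewrite (negPf fg).
  move=> /eqP->; apply/nandP; right; apply/eqP=> /setP/(_ f).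
  by rewrite !inE eqxx (negPf fg).
have cAB : #|A :|: B| = overlap f g + lone U f.
  by apply/eqP; rewrite (leq_card_setU A B).2.
have -> : overlap f g + lone U f + lone U g = #|A :|: B :|: C|.
  by apply/esym/eqP; rewrite -cAB (leq_card_setU _ _).2.
apply/subset_leq_card/subsetP=> p; rewrite doomedE sq active_star.
rewrite !inE => /orP[/orP[]|] /andP[pf].
- by move=> pg; rewrite st // cards2 fg subxx.
- by move=> /eqP->; rewrite cards1 sub1set !inE eqxx.
- by move=> /eqP->; rewrite cards1 sub1set !inE eqxx orbT.
Qed.

Lemma overlap_gt0 f g p : p \in F f -> p \in F g -> 0 < overlap f g.
Proof. by move=> pf pg; apply/card_gt0P; exists p; rewrite inE pf. Qed.

Lemma overlapC f g : overlap f g = overlap g f.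
Proof. by rewrite /overlap setIC. Qed.

(** A vertex that [f] shares with [h], together with [w], would make [U] open. *)
Lemma isolated_edge U f w : maxdeg 2 U -> ~~ open U -> star U w = [set f] ->
  forall h, h \in U -> h != f -> overlap f h = 0.
Proof.
move=> dU nopen wf h hU hf.
have fU : f \in U by have := set11 f; rewrite -wf => /setIdP[].
apply/eqP; rewrite -leqn0 leqNgt; apply: contra nopen => /card_gt0P[p].
rewrite inE => /andP[pf ph].
have fhp : [set f; h] \subset star U p.
  by apply/subsetP=> i; rewrite !inE => /orP[] /eqP->; rewrite ?fU ?hU.
apply/existsP; exists p; apply/existsP; exists w.
have c2 : 2 <= #|star U p|.
  by apply: leq_trans (subset_leq_card fhp); rewrite cards2 eq_sym hf.
by rewrite wf cards1 eqn_leq dU c2 sub1set inE fU.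
Qed.

(** The heart of the degree-two phase. Edge-hitter has chosen [v], which hits [x]
    and [y]; Staller has answered with [s], which hits only [z] and dooms only
    itself. So each vertex of [F z] other than [s] lies on a further edge [f] that
    is still to be hit. If the outcome were not open, then [f] would have lost all
    its neighbours but [x], [y], [z]: its four vertices are shared with these three
    edges or lie on [f] alone. The hypothesis on [doomed] forbids large overlaps.
    When [b] is false this is contradictory for a single [f]; when [b] is true,
    two such edges [f1], [f2] need more room than [x], [y] and [z] offer. *)
Lemma open_after_cheap_reply U v s z (b : bool) (U1 := hit U v) (U2 := hit U1 s) :
  maxdeg 2 U -> #|star U v| = 2 ->
  (forall q, #|star U q| = 2 -> #|doomed U q| <= 1 + b) ->
  (b -> exists2 u, #|star U u| = 1 & star U u \subset star U v) ->
  star U1 s = [set z] -> #|doomed U1 s| = 1 -> open U2.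
Proof.
move=> dU v2 db ub sz ds; apply: contraT => nopen.
have [x [y [xy vxy lx]]] : exists x y,
    [/\ x != y, star U v = [set x; y] & b -> 0 < lone U x].
  have /cards2P[x [y [xy vxy]]] : #|star U v| == 2 by rewrite v2.
  case: (boolP b) => [/ub [u /eqP/cards1P[i ui]]|_]; last by exists x, y.
  have iu : 0 < lone U i.
    apply/card_gt0P; exists u; rewrite inE ui eqxx andbT.
    by have := set11 i; rewrite -ui => /setIdP[].
  rewrite ui vxy sub1set => /set2P[] ?; subst i; first by exists x, y.
  by exists y, x; split=> //; rewrite 1?eq_sym // setUC.
have star_v i : (i \in U) && (v \in F i) = (i == x) || (i == y).
  by have /setP/(_ i) := vxy; rewrite !inE.
have U1E i : (i \in U1) = [&& i \in U, i != x & i != y].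
  rewrite -negb_or -star_v inE; by case: (i \in U).
have star_s i : (i \in U1) && (s \in F i) = (i == z).
  by have /setP/(_ i) := sz; rewrite !inE.
have U2E i : (i \in U2) = (i \in U1) && (i != z).
  rewrite -star_s inE; by case: (i \in U1).
have /andP[xU vx] : (x \in U) && (v \in F x) by rewrite star_v eqxx.
have /andP[yU vy] : (y \in U) && (v \in F y) by rewrite star_v eqxx orbT.
have /andP[zU1 zs] : (z \in U1) && (s \in F z) by rewrite star_s.
have := zU1; rewrite U1E => /and3P[zU zx zy].
have neighbour w : w \in F z -> w != s ->
    exists f, [/\ f \in U2, w \in F f & star U2 w = [set f]].
  move=> wz ws.
  have sd : s \in doomed U1 s.
    by apply: doomed_self; rewrite active_star sz cards1.
  have : w \notin doomed U1 s.
    have /cards1P[s' e] : #|doomed U1 s| == 1 by rewrite ds.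
    by move: sd; rewrite e !inE => /eqP <-.
  have zw : z \in star U1 w by rewrite inE wz andbT U1E zU zx.
  have -> : (w \in doomed U1 s) = (star U1 w \subset [set z]).
    by rewrite doomedE sz inE -card_gt0 (cardD1 z) zw.
  case/subsetPn=> f /setIdP[fU1 wf] /[!inE] fz.
  have fU2 : f \in U2 by rewrite U2E fU1.
  exists f; split=> //; apply/eqP; rewrite eqEsubset sub1set.
  apply/andP; split; last by rewrite inE fU2.
  apply/subsetP=> i /setIdP[iU2 wi]; rewrite inE; apply: contraT => fi.
  have : [set z; f; i] \subset star U w.
    apply/subsetP=> j; rewrite !inE => /orP[/orP[]|] /eqP->.
    - by rewrite zU.
    - by rewrite wf andbT; move: fU1; rewrite U1E => /andP[].
    by rewrite wi andbT; move: iU2; rewrite U2E U1E => /andP[/andP[]].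
  move/subset_leq_card/leq_trans/(_ (dU w)).
  have /andP[_ iz] : (i \in U1) && (i != z) by rewrite -U2E.
  by rewrite -setUA !cardsU1 cards1 !inE ![z == _]eq_sym (negPf fz) (negPf iz)
    (eq_sym f) (negPf fi).
have U2U i : i \in U2 -> [/\ i \in U, i != x, i != y & i != z].
  by rewrite U2E U1E => /andP[/and3P[]].
(* The vertices of f are distributed over x, y, z and f alone; the remaining
   conjuncts limit each share. *)
have bound f w : f \in U2 -> w \in F z -> w \in F f -> star U2 w = [set f] ->
  [/\ 4 <= lone U f + overlap f x + overlap f y + overlap f z, 0 < overlap f z,
      0 < overlap f x -> overlap f x + lone U f + lone U x <= 1 + b,
      0 < overlap f y -> overlap f y + lone U f + lone U y <= 1 + b &
      overlap f z + lone U f + lone U z <= 1 + b].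
  move=> fU2 wz wf w1; have [fU fx fy fz] := U2U f fU2.
  have mz : 0 < overlap f z := overlap_gt0 wf wz.
  split=> //; try by [apply: overlap_lone_le]; last first.
  have := @edge_count_cover U f [:: x; y; z] dU fU.
  rewrite /= !inE negb_or xy (eq_sym x) zx (eq_sym y) zy => /(_ erefl).
  rewrite !big_cons big_nil addn0 !addnA; apply=> h hU hf.
  rewrite !inE !negb_or => /and3P[hx hy hz].
  apply: (isolated_edge (maxdeg_hit _ (maxdeg_hit _ dU)) nopen w1) => //.
  by rewrite U2E U1E hU hx hy.
have cv : overlap x y + lone U x + lone U y <= 1 + b.
  by apply: overlap_lone_le => //; apply: overlap_gt0 vx vy.
have vxy0 : 0 < overlap x y := overlap_gt0 vx vy.
have /card_gt0P[w1] : 0 < #|F z :\ s|.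
  by have := F4 z; rewrite (cardsD1 s) zs; clear; lia.
rewrite !inE => /andP[w1s w1z].
have [f1 [f1U w1f w1i]] := neighbour w1 w1z w1s.
have [f1ge f1z f1x f1y f1zle] := bound f1 w1 f1U w1z w1f w1i.
have [f1U0 f1nx f1ny f1nz] := U2U f1 f1U.
case: (boolP b) => [bp|/negbTE b0]; last first.
  (* Every overlap of f1 is at most 1 and f1 has no degree-1 vertex: the three
     overlaps cannot account for its four vertices. *)
  by move: f1ge f1x f1y f1z f1zle; rewrite b0; clear; lia.
have lx1 := lx bp.
have sf1 : s \notin F f1.
  move: (f1U); rewrite U2E => /andP[fU1 _]; have := star_s f1.
  by rewrite fU1 (negPf f1nz) /= => ->.
(* F z minus s has three vertices and f1 takes at most two of them, so a vertex
   w2 leads to an edge f2 different from f1. *)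
have /subsetPn[w2] : ~~ ((F z :\ s) \subset F f1 :&: F z).
  apply/negP=> /subset_leq_card; rewrite -/(overlap f1 z).
  by have := F4 z; rewrite (cardsD1 s) zs; move: f1zle; rewrite bp; clear; lia.
rewrite !inE => /andP[w2s w2z]; rewrite w2z andbT => w2f1.
have [f2 [f2U w2f w2i]] := neighbour w2 w2z w2s.
have [f2ge f2z f2x f2y f2zle] := bound f2 w2 f2U w2z w2f w2i.
have [f2U0 f2nx f2ny f2nz] := U2U f2 f2U.
have f12 : f1 != f2 by apply: contraNneq w2f1 => ->.
(* The four vertices of each of x, y and z bound the total overlap with f1 and f2,
   which f1ge, f2ge and the limits on the shares force to be at least 8. *)
have ax : lone U x + overlap x y + overlap f1 x + overlap f2 x + overlap x z <= 4.
  have := @edge_count_le U x [:: y; f1; f2; z] dU xU.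
  rewrite !big_cons big_nil addn0 !addnA (overlapC x f1) (overlapC x f2).
  apply; last first.
    apply/allP; rewrite /= !inE yU f1U0 f2U0 zU f1nx f2nx zx.
    by rewrite eq_sym xy.
  by rewrite /= !inE !negb_or f12 f1nz f2nz !(eq_sym y) f1ny f2ny zy.
have ay : lone U y + overlap x y + overlap f1 y + overlap f2 y + overlap y z <= 4.
  have := @edge_count_le U y [:: x; f1; f2; z] dU yU.
  rewrite !big_cons big_nil addn0 !addnA (overlapC y f1) (overlapC y f2)
    (overlapC y x).
  apply; last first.
    by apply/allP; rewrite /= !inE xU f1U0 f2U0 zU f1ny f2ny zy xy.
  by rewrite /= !inE !negb_or f12 f1nz f2nz !(eq_sym x) f1nx f2nx zx.
have az : lone U z + overlap x z + overlap y z + overlap f1 z + overlap f2 z <= 4.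
  have := @edge_count_le U z [:: x; y; f1; f2] dU zU.
  rewrite !big_cons big_nil addn0 !addnA (overlapC z x) (overlapC z y).
  rewrite (overlapC z f1) (overlapC z f2); apply; last first.
    by apply/allP; rewrite /= !inE xU yU f1U0 f2U0 f1nz f2nz !(eq_sym _ z) zx zy.
  by rewrite /= !inE !negb_or f12 xy !(eq_sym x) f1nx f2nx !(eq_sym y) f1ny f2ny.
(* The vertex s is on z but on neither f1 nor f2, so it uses up room on z. *)
have s_counts : 0 < lone U z + overlap x z + overlap y z.
  case sx: (s \in F x); first by have := overlap_gt0 sx zs; clear; lia.
  case sy: (s \in F y); first by have := overlap_gt0 sy zs; clear; lia.
  suff : 0 < lone U z by clear; lia.
  apply/card_gt0P; exists s; rewrite inE zs /= -sz.
  apply/eqP/setP=> i; rewrite inE [RHS]inE U1E.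
  case: (eqVneq i x) => [->|]; first by rewrite sx !andbF.
  case: (eqVneq i y) => [->|]; first by rewrite sy !andbF.
  by rewrite andbT.
move: f1ge f1x f1y f1z f1zle f2ge f2x f2y f2z f2zle cv vxy0 lx1 ax ay az s_counts.
rewrite bp; clear; lia.
Qed.

Lemma open_le_weight p U : open U <= weight p 1 U.
Proof.
case: (boolP (open U)) => // /existsP[v /existsP[u /andP[/eqP v2 _]]].
rewrite /weight mul1n addn_gt0; apply/orP; right; apply/card_gt0P; exists v.
by rewrite active_star v2.
Qed.

Lemma open_doomed U v u : #|star U v| = 2 -> #|star U u| = 1 ->
  star U u \subset star U v -> 1 < #|doomed U v|.
Proof.
move=> v2 u1 uv.
have uv' : u != v by apply: contra_eq_neq v2 => <-; rewrite u1.
have : [set u; v] \subset doomed U v.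
  by apply/subsetP=> i; rewrite in_set2 => /orP[] /eqP->;
    rewrite doomedE active_star ?u1 ?v2 /=.
by move/subset_leq_card; rewrite cards2 uv'.
Qed.

Lemma doomed_maxdeg1 U v : maxdeg 1 U -> v \in active U -> 3 < #|doomed U v|.
Proof.
move=> dU; rewrite inE => /set0Pn[i]; rewrite inE => /andP[iU vi].
rewrite -(F4 i); apply/subset_leq_card/subsetP=> w wi.
have iw : [set i] \subset star U w by rewrite sub1set inE iU.
have /eqP wE : [set i] == star U w by rewrite eqEcard iw cards1 dU.
by rewrite doomedE active_star -wE cards1 sub1set inE iU.
Qed.

End Residual.

(** * The game on the edges left to hit *)

Section Game.
Variables (H : hypergraph) (H4 : uniform 4 H).
Implicit Types (D : {set vertex H}) (U : {set 'I_(m_of H)}) (v u : vertex H).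

(** Edges are indexed, so that repeated edges are told apart. *)
Definition edge (i : 'I_(m_of H)) : {set vertex H} := nth set0 (edges H) i.
Definition unhit D := [set i | [disjoint edge i & D]].
Notation active := (active edge).
Notation star := (star edge).
Notation hit := (hit edge).
Notation doomed := (doomed edge).
Notation maxdeg := (maxdeg edge).
Notation open := (open edge).
Notation weight := (weight edge).

Lemma edge_card i : #|edge i| = 4.
Proof. by apply: H4; rewrite -[_ \in _]/(_ \in (edges H : seq _)) mem_nth. Qed.

Lemma unhit_hit D v : unhit (v |: D) = hit (unhit D) v.
Proof.
apply/setP=> i; rewrite !inE -!setI_eq0 setIUr setU_eq0 andbC.
by rewrite (setIC _ [set v]) [[set v] :&: _ == _]setI_eq0 disjoints1.
Qed.

Lemma transversalE D : Defs.transversal D = (unhit D == set0).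
Proof.
apply/allP/eqP => [tD|U0 e].
  apply/setP=> i; rewrite !inE -setI_eq0 setIC; apply/negbTE/tD.
  exact: mem_nth.
case/(nthP set0)=> i im <-.
have /setP/(_ (Ordinal im)) := U0; rewrite !inE -setI_eq0 setIC.
by move/negbT.
Qed.

Lemma legalE D v : legal D v = (v \in active (unhit D)).
Proof.
have miss e : ~~ [exists u in D, hits u e] = [disjoint e & D].
  apply/existsPn/pred0P => [no u|dis u].
    by have := no u; rewrite /= /hits andbC => /negbTE.
  by have /= := dis u; rewrite /hits andbC => ->.
apply/hasP/idP => [[e /(nthP set0)[i im <-]]|].
  rewrite miss => /andP[vi di]; rewrite inE; apply/set0Pn.
  by exists (Ordinal im); rewrite !inE di.
rewrite inE => /set0Pn[i]; rewrite !inE => /andP[di vi].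
exists (edge i); last by rewrite miss /hits vi.
exact: mem_nth.
Qed.

(** At Edge-hitter's turn with the edges [U] left, each move being charged [c], the
    rest of the game costs at most [X]. *)
Definition within c U X :=
  forall D, unhit D = U -> c * game_value EdgeHitter D <= X.

Lemma within_set0 c X : within c set0 X.
Proof.
move=> D /eqP; rewrite -transversalE => /game_value_transversal->.
by rewrite muln0.
Qed.

(** If the game ends with the move [v], it costs [c]; otherwise that move and
    Staller's reply [u] cost [2 * c] together. *)
Lemma within_step c U v X : v \in active U -> c <= X ->
  (forall u, u \in active (hit U v) ->
     exists2 Y, within c (hit (hit U v) u) Y & Y + c.*2 <= X) ->
  within c U X.
Proof.
move=> av cX reply D UD.
have lv : legal D v by rewrite legalE UD.
have tD : ~~ Defs.transversal D.
  by rewrite transversal_no_legal negbK; apply/existsP; exists v.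
set k := game_value Staller (v |: D).
have gk : game_value EdgeHitter D <= k.+1.
  by apply/(game_value_EdgeHitter _ tD); exists v.
suff ck : c * k.+1 <= X by apply: leq_trans ck; rewrite leq_mul2l gk orbT.
case: (boolP (Defs.transversal (v |: D))) => [tv|tv].
  by rewrite /k game_value_transversal // muln1.
have /(game_value_Staller _ tv)[u lu ku] := leqnn k.
rewrite legalE unhit_hit UD in lu; have [Y wY YX] := reply u lu.
have := wY (u |: (v |: D)); rewrite !unhit_hit UD => /(_ erefl) cY.
set e := game_value EdgeHitter (u |: (v |: D)) in ku cY.
apply: leq_trans YX; apply: leq_trans (_ : c * e.+2 <= _).
  by rewrite leq_mul2l ltnS ku orbT.
by rewrite mulnC !mulSn mulnC addnA addnn addnC leq_add2r.
Qed.

Lemma within_rescale c c' U X X' :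
  within c U X -> 0 < c -> c' * X <= c * X' -> within c' U X'.
Proof.
move=> w c0 le D /w wD; rewrite -(leq_pmul2l c0); apply: leq_trans le.
by rewrite mulnCA leq_mul2l wD orbT.
Qed.

(** As long as some vertex has degree above [k], Edge-hitter chooses such a vertex.
    His move removes at least [k.+1] edges and one active vertex, and Staller's
    reply at least one of each, which by assumption pays for both moves. *)
Lemma greedy_bound c p q k : c <= k.+1 * p + q -> c.*2 <= k.+2 * p + q.*2 ->
  (forall U, maxdeg k U -> within c U (weight p q U)) ->
  forall U, within c U (weight p q U).
Proof.
move=> c1 c2 base; apply: round_ind => U IH.
case: (boolP [forall v, #|star U v| <= k]) => [/forallP|/forallPn[v]].
  exact: base.
rewrite -ltnNge => kv.
have av : v \in active U by rewrite active_star; apply: leq_trans kv.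
have pk : k.+1 * p <= p * #|star U v| by rewrite mulnC leq_mul2l kv orbT.
have qd V w : w \in active V -> q <= q * #|doomed V w|.
  by move=> aw; rewrite leq_pmulr // card_doomed_gt0.
have fv := weight_hit edge p q U v; have qv := qd _ _ av.
apply: (within_step av); first by move: c1 fv pk qv; clear; lia.
move=> u au; exists (weight p q (hit (hit U v) u)); first exact: IH.
have fu := weight_hit edge p q (hit U v) u; have qu := qd _ _ au.
have pu : p <= p * #|star (hit U v) u| by rewrite leq_pmulr // -active_star.
by move: c2 fv fu pk qv qu pu; clear; rewrite !mulSn; lia.
Qed.

(** A move at a vertex of degree 2 removes 10 from the edge term and Staller's reply
    removes 5 from it; with the two chosen vertices this makes 17, one less than
    the price of two moves. The missing unit is borrowed when the position is
    not open, on condition that it becomes open, and is owed while it is. In an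
    open position Edge-hitter has a move that dooms a second vertex, so the debt
    does not grow; it must be paid before the position ceases to be open. *)
Lemma maxdeg2_bound U : maxdeg 2 U -> within 9 U (weight 5 1 U - open U).
Proof.
move: U; apply: round_ind => U IH dU.
case: (eqVneq U set0) => [->|U0]; first exact: within_set0.
have step v : v \in active U ->
    9 + open U <= 5 * #|star U v| + #|doomed U v| ->
    (forall u (U1 := hit U v), u \in active U1 ->
      18 + open U <= 5 * #|star U v| + #|doomed U v|
        + (5 * #|star U1 u| + #|doomed U1 u|) + open (hit U1 u)) ->
    within 9 U (weight 5 1 U - open U).
  move=> av l1 l2; have f1 := weight_hit edge 5 1 U v.
  apply: (within_step av); first by move: f1 l1; clear; lia.
  move=> u au; have f2 := weight_hit edge 5 1 (hit U v) u.
  have f3 := l2 u au.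
  exists (weight 5 1 (hit (hit U v) u) - open (hit (hit U v) u)).
    by apply: IH => //; do 2!apply: maxdeg_hit.
  have o2 := open_le_weight edge 5 (hit (hit U v) u).
  by move: f1 f2 f3 o2; clear; lia.
(* With disjoint edges, each move removes one edge and its four vertices, which
   is worth exactly 9. *)
case: (boolP [forall v, #|star U v| <= 1]) => [/forallP d1|/forallPn[v0]].
  have [v av] := active_exists edge_card U0.
  have o0 : open U = false.
    apply/negbTE/existsPn=> w; apply/existsPn=> u.
    by apply/nandP; left; rewrite neq_ltn ltnS d1.
  have dv := doomed_maxdeg1 edge_card d1 av; have sv := av.
  rewrite active_star in sv.
  apply: (step v) => //; rewrite o0; first by move: sv dv; clear; lia.
  move=> u U1 au.
  have du := doomed_maxdeg1 edge_card (maxdeg_hit v d1) au.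
  rewrite active_star in au.
  by move: sv dv au du; rewrite -/U1; clear; lia.
rewrite -ltnNge => v02; have {v02}v02 : #|star U v0| = 2.
  by apply/eqP; rewrite eqn_leq dU.
have active2 v : #|star U v| = 2 -> v \in active U by rewrite active_star => ->.
have reply v u : u \in active (hit U v) ->
    6 <= 5 * #|star (hit U v) u| + #|doomed (hit U v) u|.
  move=> au; have := card_doomed_gt0 au; rewrite active_star in au.
  by move: au; clear; lia.
case: (boolP [forall v, (#|star U v| == 2) ==> (#|doomed U v| <= 1 + open U)]).
  move=> /forallP db.
  have [v v2 ov] : exists2 v, #|star U v| = 2 &
      open U -> exists2 u, #|star U u| = 1 & star U u \subset star U v.
    case: (boolP (open U)) => [/existsP[v /existsP[u]]|_]; last by exists v0.
    by case/and3P=> /eqP v2 /eqP u1 uv; exists v => // _; exists u.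
  have dv : 1 + open U <= #|doomed U v|.
    case: (boolP (open U)) ov => [_ []// u u1 uv|_ _].
      exact: open_doomed v2 u1 uv.
    by rewrite card_doomed_gt0 ?active2.
  apply: (step v); first exact: active2.
    by rewrite v2; move: dv; clear; lia.
  move=> u U1 au; have ru := reply v u au; rewrite v2.
  case: (leqP 7 (5 * #|star U1 u| + #|doomed U1 u|)) => [r7|r7].
    by move: dv r7; clear; lia.
  (* The cheapest reply, worth exactly 6, leaves an open position. *)
  suff -> : open (hit U1 u) by move: dv ru; rewrite -/U1; clear; lia.
  have su : #|star U1 u| = 1 /\ #|doomed U1 u| = 1.
    have := card_doomed_gt0 au; rewrite active_star in au.
    by move: au r7; clear; lia.
  have [/eqP/cards1P[z uz] du1] := su.
  apply: (open_after_cheap_reply (b := open U) edge_card dU v2 _ _ uz du1).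
    by move=> q /eqP q2; have := db q; rewrite q2.
  exact: ov.
(* Otherwise some move dooms enough vertices to settle everything at once. *)
case/forallPn=> v; rewrite negb_imply -ltnNge => /andP[/eqP v2 dv].
apply: (step v); first exact: active2.
  by rewrite v2; move: dv; clear; lia.
move=> u U1 au; have ru := reply v u au; rewrite v2.
by move: dv ru; rewrite -/U1; clear; lia.
Qed.

(** The weights of each phase are determined from the bottom up: they have to dominate,
    at a common price of a move, the bound for smaller degrees on every position
    with [4 * #|U| <= k * #|active U|], and to pay for a greedy round. *)
Lemma edge_hitter_bound U : within 252 U (weight 71 71 U).
Proof.
have deg2 U' : maxdeg 2 U' -> within 9 U' (weight 5 1 U').
  move=> dU; apply: (within_rescale (maxdeg2_bound dU)) => //.
  by rewrite leq_mul2l leq_subr orbT.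
have deg3 : forall U', within 27 U' (weight 11 5 U').
  apply: (@greedy_bound _ _ _ 2) => // U' dU.
  apply: (within_rescale (deg2 U' dU)) => //.
  by have := handshake edge_card dU; rewrite /weight; lia.
have deg4 : forall U', within 378 U' (weight 110 103 U').
  apply: (@greedy_bound _ _ _ 3) => // U' dU.
  apply: (within_rescale (deg3 U')) => //.
  by have := handshake edge_card dU; rewrite /weight; lia.
apply: (@greedy_bound _ _ _ 4) => // U' dU.
apply: (within_rescale (deg4 U')) => //.
by have := handshake edge_card dU; rewrite /weight; lia.
Qed.

End Game.

Local Open Scope ring_scope.

Theorem theorem6 (H : hypergraph) (H4 : uniform 4 H) :
  (tau_g H)%:R <= 71%:R / 252%:R * (n_of H + m_of H)%:R :> rat.
Proof.
have bound : (252 * tau_g H <= 71 * (n_of H + m_of H))%N.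
  apply: leq_trans (edge_hitter_bound H4 (erefl (unhit set0))) _.
  rewrite /weight -mulnDr leq_mul2l addnC leq_add ?max_card //=.
  by rewrite (leq_trans (max_card _)) // card_ord.
rewrite mulrAC ler_pdivlMr ?ltr0n // -!natrM ler_nat.
by rewrite mulnC.
Qed.
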